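(* $\mathrm{PatSort3}$ is a sorting algorithm on lists of natural numbers: for every finite list $l$ of natural numbers, $\mathrm{permutation}(\mathrm{PatSort3}(l),\,l)$ holds and $\mathrm{IsSorted}(\mathrm{PatSort3}(l))$ holds.
   Context: All lists are finite lists of natural numbers; $\mathrm{nil}$ is the empty list, $a::l$ is the list with head $a$ and tail $l$, $++$ is concatenation, $[a]=a::\mathrm{nil}$. $\mathrm{count}(e,l)$ is the number of occurrences of $e$ in $l$; $\mathrm{In}(e,l)$ means $e$ occurs in $l$. $\mathrm{permutation}(l,l')$ means: for every $e$, $\mathrm{count}(e,l)=\mathrm{count}(e,l')$ and $(\mathrm{In}(e,l)\leftrightarrow\mathrm{In}(e,l'))$. $\mathrm{IsSorted}$ is the inductive predicate generated by: $\mathrm{IsSorted}(\mathrm{nil})$; $\mathrm{IsSorted}(x::\mathrm{nil})$ for all $x$; and if $\mathrm{IsSorted}(y::l)$ and $x\le y$ then $\mathrm{IsSorted}(x::y::l)$. $\mathrm{Merge}(l_1,l_2)$: $\mathrm{Merge}(\mathrm{nil},l_2)=l_2$, $\mathrm{Merge}(l_1,\mathrm{nil})=l_1$, $\mathrm{Merge}(a::t,b::t')=a::\mathrm{Merge}(t,b::t')$ if $a\le b$, else $b::\mathrm{Merge}(a::t,t')$. $\mathrm{PatSplit}(a,b,l,Y,Z)$ (with $a,b$ naturals and $l,Y,Z$ lists, returning a pair of lists) is defined by recursion on $l$: $\mathrm{PatSplit}(a,b,\mathrm{nil},Y,Z)=((a::Y)++[b],\,Z)$; and $\mathrm{PatSplit}(a,b,c::X,Y,Z)$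 equals $\mathrm{PatSplit}(c,b,X,a::Y,Z)$ if $c\le a$; otherwise $\mathrm{PatSplit}(a,c,X,Y++[b],Z)$ if $b\le c$; otherwise $\mathrm{PatSplit}(a,b,X,Y,c::Z)$. $\mathrm{PatJoin}(X,l)$ is defined by well-founded recursion on the length of $l$: $\mathrm{PatJoin}(X,\mathrm{nil})=X$; $\mathrm{PatJoin}(X,[a])=\mathrm{Merge}(X,[a])$; $\mathrm{PatJoin}(X,a::b::Y)=\mathrm{PatJoin}(\mathrm{Merge}(X,U),V)$, where $(U,V)=\mathrm{PatSplit}(a,b,Y,\mathrm{nil},\mathrm{nil})$ if $a\le b$ and $(U,V)=\mathrm{PatSplit}(b,a,Y,\mathrm{nil},\mathrm{nil})$ otherwise. $\mathrm{PatSort3}(l)=\mathrm{PatJoin}(\mathrm{nil},l)$. *)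

(* Defs.v *)
From Stdlib Require Import List Arith Lia Sorted Recdef.
Import ListNotations.

Definition permutation (l l' : list nat) : Prop :=
  forall e : nat,
    count_occ Nat.eq_dec l e = count_occ Nat.eq_dec l' e /\ (In e l <-> In e l').

(* The constructors of [LocallySorted le] are exactly the three rules
   generating the sortedness predicate. *)
Definition IsSorted : list nat -> Prop := LocallySorted le.

(* The inner fixpoint recurses on the second list while the first is fixed. *)
Fixpoint Merge (l1 l2 : list nat) : list nat :=
  let fix Merge_aux l2 :=
    match l1, l2 with
    | [], _ => l2
    | _, [] => l1
    | a :: t, b :: t' =>
        if a <=? b then a :: Merge t l2 else b :: Merge_aux t'
    end
  in Merge_aux l2.

Fixpoint PatSplit (a b : nat) (l Y Z : list nat) : list nat * list nat :=
  match l with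
  | [] => ((a :: Y) ++ [b], Z)
  | c :: X =>
      if c <=? a then PatSplit c b X (a :: Y) Z
      else if b <=? c then PatSplit a c X (Y ++ [b]) Z
      else PatSplit a b X Y (c :: Z)
  end.

Lemma PatSplit_snd_length (l : list nat) : forall (a b : nat) (Y Z : list nat),
  length (snd (PatSplit a b l Y Z)) <= length l + length Z.
Proof.
induction l as [|c X IH]; intros a b Y Z; simpl; [lia|].
destruct (c <=? a); [|destruct (b <=? c)].
- specialize (IH c b (a :: Y) Z); lia.
- specialize (IH a c (Y ++ [b]) Z); lia.
- specialize (IH a b Y (c :: Z)); simpl in IH; lia.
Qed.

Function PatJoin (X l : list nat) {measure length l} : list nat :=
  match l with
  | [] => X
  | [a] => Merge X [a]
  | a :: b :: Y =>
      match (if a <=? b then PatSplit a b Y [] [] else PatSplit b a Y [] []) with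
      | (U, V) => PatJoin (Merge X U) V
      end
  end.
Proof.
all: intros X l a l' b Y _ _ _ U V E.
- pose proof (PatSplit_snd_length Y a b [] []) as H.
  rewrite E in H; simpl in *; lia.
- pose proof (PatSplit_snd_length Y b a [] []) as H.
  rewrite E in H; simpl in *; lia.
Defined.

Definition PatSort3 (l : list nat) : list nat := PatJoin [] l.

(* Main.v *)
(** Two invariants suffice. In a call [PatSplit a b l Y Z] the list [a :: Y ++ [b]]
    is a sorted run, which an element [c] extends at the front when [c <= a] and at
    the back when [b <= c]; so [PatSplit] detaches a sorted run from its input. In
    [PatJoin X l] the accumulator [X] stays sorted, since only such runs are merged
    into it. *)

Require Import Defs.
From Stdlib Require Import List.
From Stdlib Require Import Arith Sorted Permutation FunInd.
Import ListNotations.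

Lemma Permutation_permutation (l l' : list nat) :
  Permutation l l' -> permutation l l'.
Proof.
intros H e; split.
- now apply Permutation_count_occ.
- split; apply Permutation_in; [|symmetry]; exact H.
Qed.

Lemma Merge_nil_r (l : list nat) : Merge l [] = l.
Proof. now destruct l. Qed.

(** Rewriting with this equation keeps the inner fixpoint of [Merge] folded. *)
Lemma Merge_cons (a b : nat) (t t' : list nat) :
  Merge (a :: t) (b :: t') =
  if a <=? b then a :: Merge t (b :: t') else b :: Merge (a :: t) t'.
Proof. reflexivity. Qed.

Lemma Permutation_Merge (l1 l2 : list nat) : Permutation (Merge l1 l2) (l1 ++ l2).
Proof.
revert l2; induction l1 as [|a t IH1]; intros l2; [now destruct l2|].
(* The inner induction mirrors the nested fixpoint: when [b] is taken, the first list stays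
   [a :: t]. *)
induction l2 as [|b t' IH2]; [now rewrite Merge_nil_r, app_nil_r|].
rewrite Merge_cons; destruct (a <=? b).
- simpl; now rewrite IH1.
- rewrite IH2; apply Permutation_middle.
Qed.

(** The head of a merge is the head of one of its arguments. *)
Lemma HdRel_Merge (x : nat) (l1 l2 : list nat) :
  HdRel le x l1 -> HdRel le x l2 -> HdRel le x (Merge l1 l2).
Proof.
destruct l1 as [|a t], l2 as [|b t']; intros H1 H2; trivial.
rewrite Merge_cons.
destruct (a <=? b); constructor; eapply HdRel_inv; eassumption.
Qed.

Lemma Sorted_Merge (l1 l2 : list nat) :
  Sorted le l1 -> Sorted le l2 -> Sorted le (Merge l1 l2).
Proof.
revert l2; induction l1 as [|a t IH1]; intros l2 H1 H2; [now destruct l2|].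
induction l2 as [|b t' IH2]; [exact H1|].
rewrite Merge_cons.
destruct (Sorted_inv H1) as [Ht Ha], (Sorted_inv H2) as [Ht' Hb].
destruct (Nat.leb_spec a b) as [Hab|Hba]; constructor; auto.
- apply HdRel_Merge; auto.
- apply HdRel_Merge; auto using Nat.lt_le_incl.
Qed.

Lemma Sorted_snoc {A : Type} (R : A -> A -> Prop) (l : list A) (b c : A) :
  Sorted R (l ++ [b]) -> R b c -> Sorted R ((l ++ [b]) ++ [c]).
Proof.
intros H Hbc; induction l as [|a l IH]; [repeat (constructor; auto)|].
destruct (Sorted_inv H) as [Hl Ha]; simpl; constructor; auto.
destruct l; inversion Ha; now constructor.
Qed.

Lemma Sorted_PatSplit (l : list nat) (a b : nat) (Y Z : list nat) :
  Sorted le ((a :: Y) ++ [b]) -> Sorted le (fst (PatSplit a b l Y Z)).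
Proof.
revert a b Y Z; induction l as [|c l IH]; intros a b Y Z H; [exact H|]; simpl.
destruct (Nat.leb_spec c a) as [Hca|_].
- apply IH; simpl in *; constructor; auto.
- destruct (Nat.leb_spec b c) as [Hbc|_]; [|auto].
  (* The new run [(a :: (Y ++ [b])) ++ [c]] is convertible to [((a :: Y) ++ [b]) ++ [c]]. *)
  now apply IH, (Sorted_snoc le (a :: Y)).
Qed.

Lemma Permutation_PatSplit (l : list nat) (a b : nat) (Y Z : list nat) :
  Permutation (fst (PatSplit a b l Y Z) ++ snd (PatSplit a b l Y Z))
    (a :: b :: l ++ Y ++ Z).
Proof.
revert a b Y Z; induction l as [|c l IH]; intros a b Y Z; simpl.
- rewrite <- app_assoc; constructor; symmetry; apply Permutation_middle.
- destruct (c <=? a); [|destruct (b <=? c)]; rewrite IH;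
    (* Each branch only moves [c], so counting occurrences leaves an identity between sums in
       [nat]. *)
    apply (Permutation_count_occ Nat.eq_dec); intros e;
    repeat (rewrite count_occ_app || simpl);
    repeat destruct (Nat.eq_dec _ e); ring.
Qed.

Lemma Permutation_PatJoin (X l : list nat) : Permutation (PatJoin X l) (X ++ l).
Proof.
functional induction (PatJoin X l)
  as [X l|X l a|X l a b Y Hl Hab U V E IH|X l a b Y Hl Hab U V E IH].
- now rewrite app_nil_r.
- apply Permutation_Merge.
- rewrite IH, Permutation_Merge, <- app_assoc; apply Permutation_app_head.
  generalize (Permutation_PatSplit Y a b [] []).
  rewrite E, !app_nil_r; intros H; exact H.
- rewrite IH, Permutation_Merge, <- app_assoc; apply Permutation_app_head.
  generalize (Permutation_PatSplit Y b a [] []).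
  (* [PatSplit] received the two heads in swapped order; the last step is the transposition of [b]
     and [a]. *)
  rewrite E, !app_nil_r; intros H; simpl in *; rewrite H; constructor.
Qed.

Lemma Sorted_PatJoin (X l : list nat) : Sorted le X -> Sorted le (PatJoin X l).
Proof.
functional induction (PatJoin X l)
  as [X l|X l a|X l a b Y Hl Hab U V E IH|X l a b Y Hl Hab U V E IH]; intros HX.
- exact HX.
- apply Sorted_Merge; auto.
- apply IH, Sorted_Merge; [exact HX|].
  (* The run starts as [[a; b]], sorted by the test [a <=? b]; the other case starts from
     [[b; a]]. *)
  change U with (fst (U, V)); rewrite <- E.
  apply Nat.leb_le in Hab; apply Sorted_PatSplit; simpl; auto.
- apply IH, Sorted_Merge; [exact HX|].
  change U with (fst (U, V)); rewrite <- E.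
  apply Nat.leb_gt in Hab; apply Sorted_PatSplit; simpl;
    auto using Nat.lt_le_incl.
Qed.

Theorem mainTheorem4 (l : list nat) :
  permutation (PatSort3 l) l /\ IsSorted (PatSort3 l).
Proof.
split.
- apply Permutation_permutation, (Permutation_PatJoin []).
(* The lemmas use [Sorted], whose [HdRel] premise separates the bound on the head from the
   sortedness of the tail. *)
- apply Sorted_LocallySorted_iff, Sorted_PatJoin; constructor.
Qed.
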